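(* Let $m\ge 0$ be an integer, let $q>2$, and set $\alpha=\frac{q-2}{2m+q}\in(0,1)$. Then the function $u(x)=\operatorname{sign}(x)\,|x|^\alpha$ on $(-1,1)\subset\mathbb{R}$, which is not Lipschitz at $0$, is a viscosity solution of $$\arctan(u'')=-\arctan\left(C_1^{-1}\,u^{2m+1}\,(u')^q\right),\qquad C_1=\frac{\alpha^{q-1}}{1-\alpha}>0.$$ (In particular, for $m=0$ and $\alpha=(q-2)/q$, $u$ is a viscosity solution of $\arctan(u'')=-\arctan\left((1-\alpha)\alpha^{1-q}u(u')^q\right)$.) The phase $\Theta(z,p)=-\arctan(C_1^{-1}z^{2m+1}p^q)$ fails the condition $\Theta_z\ge 0$ on $\{z\in\mathbb{R},\ p>0\}$.
   Context: A continuous function $u$ is a viscosity solution of $\arctan(u'')=\Theta(x,u,u')$ on an open interval if, for every $x_0$ and every $C^2$ function $\varphi$ near $x_0$ with $\varphi(x_0)=u(x_0)$: if $\varphi\ge u$ near $x_0$ then $\arctan\varphi''(x_0)\ge\Theta(x_0,u(x_0),\varphi'(x_0))$, and if $\varphi\le u$ near $x_0$ then $\arctan\varphi''(x_0)\le\Theta(x_0,u(x_0),\varphi'(x_0))$. The phase is given by the formula for $p>0$ and may be extended arbitrarily to $p\le0$ when $p^q$ is not defined there. *)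

(* Defs.v *)
From Stdlib Require Export Reals.
From Coquelicot Require Export Coquelicot.
Open Scope R_scope.

(* [Derive] is total, so differentiability is required at every order
   separately; the order-0 instance is continuity of [phi] itself. *)
Definition C2_near (phi : R -> R) (x0 : R) : Prop :=
  locally x0 (fun x => forall k : nat, (k <= 2)%nat ->
    ex_derive_n phi k x /\ continuous (Derive_n phi k) x).

(* Viscosity solution of [arctan u'' = Theta (x, u, u')] on the open interval
   [(a, b)].  All conditions are local, so [u] and the test functions may be
   total functions on [R]; only their values near points of [(a, b)] matter. *)
Definition viscosity_solution (Theta : R -> R -> R -> R) (a b : R)
    (u : R -> R) : Prop :=
  (forall x : R, a < x < b -> continuous u x) /\
  (forall (x0 : R) (phi : R -> R),
     a < x0 < b -> C2_near phi x0 -> phi x0 = u x0 ->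
     (locally x0 (fun x => phi x >= u x) ->
        atan (Derive_n phi 2 x0) >= Theta x0 (u x0) (Derive phi x0)) /\
     (locally x0 (fun x => phi x <= u x) ->
        atan (Derive_n phi 2 x0) <= Theta x0 (u x0) (Derive phi x0))).

(* [Rpower 0 alpha] is the junk value 1, but the factor [sign 0 = 0] makes the
   value at the origin 0, as it should be. *)
Definition signed_power (alpha x : R) : R := sign x * Rpower (Rabs x) alpha.

Definition Lipschitz_at (u : R -> R) (x0 : R) : Prop :=
  exists L : R, locally x0 (fun x => Rabs (u x - u x0) <= L * Rabs (x - x0)).

(* [Rpower p q] is [p ^ q] only for [p > 0], so a phase with formula [F] is
   prescribed for [p > 0] and arbitrary for [p <= 0]. *)
Definition phase_given_by (F Theta : R -> R -> R) : Prop :=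
  forall z p : R, 0 < p -> Theta z p = F z p.

(* The condition [Theta_z >= 0] on [{z in R, p > 0}].  It is phrased with
   [is_derive] so that its negation yields a derivative that exists and is
   negative. *)
Definition phase_z_nonneg (Theta : R -> R -> R) : Prop :=
  forall z p l : R, 0 < p -> is_derive (fun t => Theta t p) z l -> 0 <= l.

(* Main.v *)
(** Away from the origin [u] is smooth and solves the equation classically, so
    a test function touching [u] there has the same slope and a comparable
    second derivative, and monotonicity of [arctan] concludes.  At the origin
    [u] has a vertical tangent, so it dominates every linear function on the
    right and is dominated on the left: no differentiable function can touch it
    from either side, and the viscosity condition is vacuous. *)
Require Import Defs.
From Stdlib Require Import Reals Lra Lia.
From Coquelicot Require Import Coquelicot.
Open Scope R_scope.

(** * Signs, and the derivative of the signed power off the origin *)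

Lemma locally_neq_0 (x0 : R) : x0 <> 0 -> locally x0 (fun x => x <> 0).
Proof.
intros hx; exists (mkposreal _ (Rabs_pos_lt _ hx)); intros y hy.
change (Rabs (y - x0) < Rabs x0) in hy.
intros ->; revert hy; unfold Rminus; rewrite Rplus_0_l, Rabs_Ropp; lra.
Qed.

Lemma locally_sign (x0 : R) : x0 <> 0 -> locally x0 (fun x => sign x = sign x0).
Proof.
intros hx; destruct (Rdichotomy _ _ hx) as [h | h].
- apply (filter_imp (fun x => x < 0)); [ | exact (open_lt 0 x0 h)].
  now intros x hx0; rewrite !sign_eq_m1.
- apply (filter_imp (fun x => 0 < x)); [ | exact (open_gt 0 x0 h)].
  now intros x hx0; rewrite !sign_eq_1.
Qed.

Lemma sign_sqr (x : R) : x <> 0 -> sign x * sign x = 1.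
Proof.
intros hx; destruct (Rdichotomy _ _ hx) as [h | h].
- rewrite (sign_eq_m1 x h); ring.
- rewrite (sign_eq_1 x h); ring.
Qed.

Lemma Rpower_pos (x y : R) : 0 < Rpower x y.
Proof. apply exp_pos. Qed.

Lemma is_derive_Rpower_Rabs (a x : R) : x <> 0 ->
  is_derive (fun t => Rpower (Rabs t) a) x (sign x * (a * Rpower (Rabs x) (a - 1))).
Proof.
intros hx.
apply (is_derive_comp (fun r => Rpower r a) Rabs x).
- apply is_derive_Reals, derivable_pt_lim_power, Rabs_pos_lt, hx.
- replace (sign x) with (sign x * 1) by ring.
  apply (is_derive_Rabs (fun t => t) x 1); [apply @is_derive_id | exact hx].
Qed.

Lemma is_derive_signed_power (a x : R) : x <> 0 ->
  is_derive (signed_power a) x (a * Rpower (Rabs x) (a - 1)).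
Proof.
intros hx.
apply (is_derive_ext_loc (fun t => sign x * Rpower (Rabs t) a)).
- apply (filter_imp (fun t => sign t = sign x)); [ | exact (locally_sign x hx)].
  now intros t ht; unfold signed_power; rewrite ht.
- replace (a * Rpower (Rabs x) (a - 1))
    with (sign x * (sign x * (a * Rpower (Rabs x) (a - 1))))
    by (rewrite <- Rmult_assoc, sign_sqr by exact hx; ring).
  apply is_derive_scal, is_derive_Rpower_Rabs, hx.
Qed.

Lemma signed_power_0 (a : R) : signed_power a 0 = 0.
Proof. unfold signed_power; rewrite sign_0; ring. Qed.

Lemma signed_power_pos (a x : R) : 0 < x -> signed_power a x = Rpower x a.
Proof.
intros hx; unfold signed_power; rewrite sign_eq_1, Rabs_right by lra; ring.
Qed.

Lemma signed_power_opp (a x : R) : signed_power a (- x) = - signed_power a x.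
Proof. unfold signed_power; rewrite sign_opp, Rabs_Ropp; ring. Qed.

(** * Growth near the origin: continuity without a Lipschitz bound *)

Lemma Rpower_small (a eps : R) : 0 < a -> 0 < eps ->
  exists d, 0 < d /\ forall x, 0 < x < d -> Rpower x a < eps.
Proof.
intros ha heps; exists (Rpower eps (/ a)); split; [apply Rpower_pos | ].
intros x hx.
replace eps with (Rpower (Rpower eps (/ a)) a).
- now apply Rlt_Rpower_l.
- rewrite Rpower_mult, Rinv_l by lra; now apply Rpower_1.
Qed.

(** Factor [x] as [Rpower x (1 - a) * Rpower x a]: the first factor tends to 0, so it eventually
    beats any constant. Working with [Rabs L + 1] provides a positive number to invert, whatever the
    sign of [L]. *)
Lemma Rpower_gt_linear (a L : R) : a < 1 ->
  exists d, 0 < d /\ forall x, 0 < x < d -> L * x < Rpower x a.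
Proof.
intros ha.
assert (hL := Rle_abs L); assert (hL0 := Rabs_pos L).
destruct (Rpower_small (1 - a) (/ (Rabs L + 1))) as [d [hd H]];
  [lra | apply Rinv_0_lt_compat; lra | ].
exists d; split; [exact hd | ]; intros x hx.
assert (hpos := Rpower_pos x a).
assert (hx1 : x = Rpower x (1 - a) * Rpower x a).
{ rewrite <- Rpower_plus; replace (1 - a + a) with 1 by ring.
  now rewrite Rpower_1. }
assert (hlt : Rpower x (1 - a) * (Rabs L + 1) < 1).
{ apply Rlt_le_trans with (/ (Rabs L + 1) * (Rabs L + 1));
    [ | rewrite Rinv_l; lra].
  apply Rmult_lt_compat_r; [lra | now apply H]. }
assert (h1 : (Rabs L + 1) * x < Rpower x a) by (rewrite hx1 at 1; nra).
nra.
Qed.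

Lemma continuous_signed_power (a x : R) : 0 < a -> continuous (signed_power a) x.
Proof.
intros ha; destruct (Req_dec x 0) as [-> | hx].
- apply filterlim_locally; intros eps.
  destruct (Rpower_small a eps ha (cond_pos eps)) as [d [hd H]].
  exists (mkposreal d hd); intros y hy; change (Rabs (y - 0) < d) in hy.
  change (Rabs (signed_power a y - signed_power a 0) < eps).
  rewrite signed_power_0; rewrite Rminus_0_r in *.
  (* [Rpower_small] covers positive arguments only; at 0 the factor [sign 0 = 0] masks the default
     value of [Rpower]. *)
  destruct (Req_dec y 0) as [-> | hy0].
  + rewrite signed_power_0, Rabs_R0; apply cond_pos.
  + assert (hy1 := Rabs_pos_lt y hy0).
    unfold signed_power; rewrite Rabs_mult.
    replace (Rabs (sign y)) with 1.
    * rewrite Rmult_1_l, Rabs_right by (apply Rle_ge, Rlt_le, Rpower_pos).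
      apply H; lra.
    * destruct (Rdichotomy _ _ hy0) as [h | h].
      -- rewrite sign_eq_m1, Rabs_left by lra; ring.
      -- rewrite sign_eq_1, Rabs_right by lra; ring.
- apply @ex_derive_continuous.
  eexists; apply is_derive_signed_power, hx.
Qed.

Lemma signed_power_not_Lipschitz_at_0 (a : R) :
  a < 1 -> ~ Lipschitz_at (signed_power a) 0.
Proof.
intros ha [L [eps H]].
destruct (Rpower_gt_linear a L ha) as [d [hd Hd]].
set (x := Rmin d eps / 2).
assert (hm : 0 < Rmin d eps) by (apply Rmin_pos; [lra | apply cond_pos]).
assert (h1 := Rmin_l d eps); assert (h2 := Rmin_r d eps).
assert (hx : 0 < x < d) by (unfold x; lra).
specialize (H x); specialize (Hd x hx).
rewrite signed_power_0, !Rminus_0_r, signed_power_pos in H by lra.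
rewrite (Rabs_right x) in H by lra.
assert (hp := Rle_abs (Rpower x a)).
enough (Rabs (Rpower x a) <= L * x) by lra.
apply H; change (Rabs (x - 0) < eps).
rewrite Rminus_0_r, Rabs_right; unfold x; lra.
Qed.

(** * No differentiable function touches the signed power at the origin *)

Lemma ex_derive_Lipschitz_at (f : R -> R) (x0 : R) :
  ex_derive f x0 -> Lipschitz_at f x0.
Proof.
intros [l hl]; apply is_derive_Reals in hl.
(* Difference quotients within 1 of [l] give the Lipschitz constant [Rabs l + 1]. *)
destruct (hl 1 Rlt_0_1) as [d Hd].
exists (Rabs l + 1), d; intros x hx; simpl in x; change (Rabs (x - x0) < d) in hx.
destruct (Req_dec x x0) as [-> | hne].
- unfold Rminus; rewrite !Rplus_opp_r, Rabs_R0; lra.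
- specialize (Hd (x - x0) ltac:(lra) hx).
  replace (x0 + (x - x0)) with x in Hd by ring.
  replace (f x - f x0) with ((f x - f x0) / (x - x0) * (x - x0)) by (field; lra).
  rewrite Rabs_mult; apply Rmult_le_compat_r; [apply Rabs_pos | ].
  replace ((f x - f x0) / (x - x0))
    with (l + ((f x - f x0) / (x - x0) - l)) by ring.
  eapply Rle_trans; [apply Rabs_triang | lra].
Qed.

(** A single small [x > 0] gives the contradiction: there [phi x <= L * x], while the power exceeds
    [L * x]. *)
Lemma signed_power_not_below_Lipschitz (a : R) (phi : R -> R) :
  a < 1 -> Lipschitz_at phi 0 -> phi 0 = 0 ->
  ~ locally 0 (fun x => phi x >= signed_power a x).
Proof.
intros ha [L HL] h0 H.
destruct (Rpower_gt_linear a L ha) as [d [hd Hd]].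
destruct (filter_and _ _ HL H) as [eps He].
set (x := Rmin d eps / 2).
assert (hm : 0 < Rmin d eps) by (apply Rmin_pos; [lra | apply cond_pos]).
assert (h1 := Rmin_l d eps); assert (h2 := Rmin_r d eps).
assert (hx : 0 < x < d) by (unfold x; lra).
destruct (He x) as [hl hp].
{ change (Rabs (x - 0) < eps).
  rewrite Rminus_0_r, Rabs_right; unfold x; lra. }
specialize (Hd x hx).
rewrite h0, !Rminus_0_r, (Rabs_right x) in hl by lra.
rewrite signed_power_pos in hp by lra.
assert (hq := Rle_abs (phi x)); lra.
Qed.

Lemma locally_0_opp (P : R -> Prop) : locally 0 P -> locally 0 (fun x => P (- x)).
Proof.
intros [eps H]; exists eps; intros x hx; apply H.
change (Rabs (- x - 0) < eps); change (Rabs (x - 0) < eps) in hx.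
rewrite Rminus_0_r, Rabs_Ropp; now rewrite Rminus_0_r in hx.
Qed.

(** The signed power is odd, so the point reflection [- phi (- x)] reduces this to touching from the
    other side. *)
Lemma signed_power_not_above_Lipschitz (a : R) (phi : R -> R) :
  a < 1 -> Lipschitz_at phi 0 -> phi 0 = 0 ->
  ~ locally 0 (fun x => phi x <= signed_power a x).
Proof.
intros ha [L HL] h0 H.
apply (signed_power_not_below_Lipschitz a (fun x => - phi (- x)) ha).
- exists L; generalize (locally_0_opp _ HL); apply filter_imp; intros x.
  rewrite Ropp_0, !Rminus_0_r, Rabs_Ropp.
  replace (- phi (- x) - - phi 0) with (- (phi (- x) - phi 0)) by ring.
  now rewrite Rabs_Ropp.
- rewrite Ropp_0; lra.
- generalize (locally_0_opp _ H); apply filter_imp; intros x.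
  rewrite signed_power_opp; lra.
Qed.

(** * First- and second-order conditions at a point of touching *)

Lemma local_min_conditions (g g' : R -> R) (x0 l : R) :
  locally x0 (fun x => is_derive g x (g' x)) -> is_derive g' x0 l ->
  locally x0 (fun x => g x0 <= g x) -> g' x0 = 0 /\ 0 <= l.
Proof.
intros Hg Hl Hmin.
destruct (filter_and _ _ Hg Hmin) as [eps He]; clear Hg Hmin.
assert (hpos := cond_pos eps).
assert (Hb : forall x, x0 - eps < x < x0 + eps ->
  is_derive g x (g' x) /\ g x0 <= g x).
{ intros x hx; apply He; change (Rabs (x - x0) < eps); apply Rabs_def1; lra. }
assert (H0 : g' x0 = 0).
{ destruct (Hb x0) as [h _]; [lra | ].
  apply is_derive_Reals in h.
  rewrite <- (deriv_minimum g (x0 - eps) (x0 + eps) x0 (exist _ _ h));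
    [reflexivity | lra | lra | ].
  intros x h1 h2; apply Hb; lra. }
split; [exact H0 | ].
(* If [l < 0] then [g' < 0] just to the right of [x0], so [g] decreases there. *)
destruct (Rle_or_lt 0 l) as [h | h]; [exact h | exfalso].
apply is_derive_Reals in Hl.
(* A difference quotient of [g'] within [- l] of [l] is still negative. *)
destruct (Hl (- l) ltac:(lra)) as [d Hd].
assert (hd := cond_pos d).
set (b := x0 + Rmin d eps / 2).
assert (hm : 0 < Rmin d eps) by (apply Rmin_pos; lra).
assert (h1 := Rmin_l d eps); assert (h2 := Rmin_r d eps).
assert (hb : x0 < b) by (unfold b; lra).
assert (hneg : forall x, x0 < x <= b -> g' x < 0).
{ intros x hx.
  assert (hlt : Rabs (x - x0) < d) by (rewrite Rabs_right; unfold b in hx; lra).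
  specialize (Hd (x - x0) ltac:(lra) hlt).
  replace (x0 + (x - x0)) with x in Hd by ring.
  apply Rabs_def2 in Hd; rewrite H0, Rminus_0_r in Hd.
  replace (g' x) with (g' x / (x - x0) * (x - x0)) by (field; lra).
  nra. }
destruct (MVT_cor2 g g' x0 b hb) as [c [hc1 hc2]].
{ intros x hx; apply is_derive_Reals, Hb; unfold b in hx; lra. }
assert (hgb : g x0 <= g b) by (apply Hb; unfold b; lra).
specialize (hneg c ltac:(lra)); nra.
Qed.

Lemma C2_near_is_derive (phi : R -> R) (x0 : R) : C2_near phi x0 ->
  locally x0 (fun x => is_derive phi x (Derive phi x)) /\
  is_derive (Derive phi) x0 (Derive_n phi 2 x0).
Proof.
intros H; split.
- revert H; unfold C2_near; apply filter_imp; intros x hx.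
  apply Derive_correct; apply (hx 1%nat); lia.
- destruct (locally_singleton _ _ H 2%nat) as [h _]; [lia | ].
  exact (Derive_correct (Derive phi) x0 h).
Qed.

(** The difference [phi - u] vanishes at [x0] and is nonnegative nearby, so it has a local minimum
    there. Touching from below is handled in the same way with [u - phi]. *)
Lemma touching_above (u u' phi : R -> R) (x0 l : R) :
  locally x0 (fun x => is_derive u x (u' x)) -> is_derive u' x0 l ->
  C2_near phi x0 -> phi x0 = u x0 -> locally x0 (fun x => phi x >= u x) ->
  Derive phi x0 = u' x0 /\ l <= Derive_n phi 2 x0.
Proof.
intros Hu Hl Hphi h0 H.
destruct (C2_near_is_derive _ _ Hphi) as [Hp1 Hp2].
destruct (local_min_conditions (fun x => phi x - u x)
  (fun x => Derive phi x - u' x) x0 (Derive_n phi 2 x0 - l)) as [h1 h2].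
- generalize (filter_and _ _ Hp1 Hu); apply filter_imp; intros x [hx1 hx2].
  exact (is_derive_minus _ _ _ _ _ hx1 hx2).
- exact (is_derive_minus _ _ _ _ _ Hp2 Hl).
- revert H; apply filter_imp; intros x; lra.
- lra.
Qed.

Lemma touching_below (u u' phi : R -> R) (x0 l : R) :
  locally x0 (fun x => is_derive u x (u' x)) -> is_derive u' x0 l ->
  C2_near phi x0 -> phi x0 = u x0 -> locally x0 (fun x => phi x <= u x) ->
  Derive phi x0 = u' x0 /\ Derive_n phi 2 x0 <= l.
Proof.
intros Hu Hl Hphi h0 H.
destruct (C2_near_is_derive _ _ Hphi) as [Hp1 Hp2].
destruct (local_min_conditions (fun x => u x - phi x)
  (fun x => u' x - Derive phi x) x0 (l - Derive_n phi 2 x0)) as [h1 h2].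
- generalize (filter_and _ _ Hp1 Hu); apply filter_imp; intros x [hx1 hx2].
  exact (is_derive_minus _ _ _ _ _ hx2 hx1).
- exact (is_derive_minus _ _ _ _ _ Hl Hp2).
- revert H; apply filter_imp; intros x; lra.
- lra.
Qed.

(** * From the classical equation to the viscosity inequalities *)

Lemma atan_le (x y : R) : x <= y -> atan x <= atan y.
Proof.
intros [h | ->]; [left; now apply atan_increasing | lra].
Qed.

(** The hypothesis on [Theta] is the classical equation off the origin, with slope and second
    derivative written out. These slopes are positive, so it concerns [Theta] only where the phase
    is prescribed. *)
Lemma signed_power_viscosity_solution (a lo hi : R) (Theta : R -> R -> R) :
  0 < a < 1 ->
  (forall x, x <> 0 ->
     Theta (signed_power a x) (a * Rpower (Rabs x) (a - 1)) =
     atan (a * (sign x * ((a - 1) * Rpower (Rabs x) (a - 1 - 1))))) ->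
  viscosity_solution (fun _ z p => Theta z p) lo hi (signed_power a).
Proof.
intros ha HTheta; split.
- intros x _; now apply continuous_signed_power.
- intros x0 phi _ Hphi h0.
  destruct (Req_dec x0 0) as [-> | hx0].
  + rewrite signed_power_0 in h0.
    assert (HL : Lipschitz_at phi 0).
    { apply ex_derive_Lipschitz_at.
      destruct (C2_near_is_derive _ _ Hphi) as [H _].
      exists (Derive phi 0); exact (locally_singleton _ _ H). }
    split; intros H; exfalso; revert H.
    * now apply signed_power_not_below_Lipschitz.
    * now apply signed_power_not_above_Lipschitz.
  + assert (Hu : locally x0 (fun x =>
      is_derive (signed_power a) x (a * Rpower (Rabs x) (a - 1)))).
    { generalize (locally_neq_0 x0 hx0); apply filter_imp.
      apply is_derive_signed_power. }
    assert (Hl := is_derive_scal _ x0 a _ (is_derive_Rpower_Rabs (a - 1) x0 hx0)).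
    split; intros H.
    * destruct (touching_above _ _ _ _ _ Hu Hl Hphi h0 H) as [-> h].
      rewrite HTheta by exact hx0; apply Rle_ge, atan_le, h.
    * destruct (touching_below _ _ _ _ _ Hu Hl Hphi h0 H) as [-> h].
      rewrite HTheta by exact hx0; apply atan_le, h.
Qed.

(** * The signed power satisfies the equation *)

Lemma sign_pow_odd (m : nat) (x : R) : x <> 0 -> sign x ^ (2 * m + 1) = sign x.
Proof.
intros hx; rewrite pow_add, pow_mult, pow_1.
replace (sign x ^ 2) with 1 by (simpl; rewrite Rmult_1_r; symmetry; now apply sign_sqr).
rewrite pow1; ring.
Qed.

(** Both sides are a constant times [sign x] times a power of [Rabs x]. The relation between [a],
    [m] and [q] is exactly the balance of the exponents, and the coefficient
    [(1 - a) / Rpower a (q - 1)] matches the constants. *)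
Lemma signed_power_equation (m : nat) (q a x : R) :
  0 < a -> a * (2 * INR m + q) = q - 2 -> x <> 0 ->
  (1 - a) / Rpower a (q - 1) * signed_power a x ^ (2 * m + 1)
    * Rpower (a * Rpower (Rabs x) (a - 1)) q
  = - (a * (sign x * ((a - 1) * Rpower (Rabs x) (a - 1 - 1)))).
Proof.
intros ha hq hx; unfold signed_power.
rewrite Rpow_mult_distr, sign_pow_odd by exact hx.
rewrite <- Rpower_pow by apply Rpower_pos.
rewrite <- Rpower_mult_distr by (exact ha || apply Rpower_pos).
rewrite !Rpower_mult.
(* This exposes the factor cancelling the denominator, leaving the constant [(1 - a) * a]. *)
replace (Rpower a q) with (Rpower a (q - 1) * a)
  by (rewrite <- (Rpower_1 a ha) at 2; rewrite <- Rpower_plus; f_equal; ring).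
replace (a - 1 - 1) with (a * INR (2 * m + 1) + (a - 1) * q).
- rewrite Rpower_plus; field; apply Rgt_not_eq, Rpower_pos.
- rewrite plus_INR, mult_INR; simpl; lra.
Qed.

(** * The phase decreases in its first argument *)

Lemma phase_z_nonneg_fails (m : nat) (q c : R) (Theta : R -> R -> R) :
  0 < c ->
  phase_given_by (fun z p => - atan (c * z ^ (2 * m + 1) * Rpower p q)) Theta ->
  ~ phase_z_nonneg Theta.
Proof.
intros hc HTheta H.
set (n := (2 * m + 1)%nat) in *.
assert (hn : 0 < INR n) by (apply lt_0_INR; unfold n; lia).
assert (hK : 0 < c * Rpower 1 q) by (apply Rmult_lt_0_compat; [lra | apply Rpower_pos]).
set (K := c * Rpower 1 q) in *.
(* The test point is [z = p = 1]: at [z = 0] the derivative would vanish as soon as [m > 0]. *)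
assert (hd : is_derive (fun t => Theta t 1) 1 (- (INR n * K / (1 + K * K)))).
{ apply (is_derive_ext (fun t => - atan (K * t ^ n))).
  - intros t; rewrite HTheta by lra; unfold K; do 2 f_equal; ring.
  - auto_derive; [trivial | ].
    rewrite !pow1; unfold Rsqr; field; nra. }
assert (h := H _ _ _ Rlt_0_1 hd).
assert (0 < INR n * K / (1 + K * K)); [ | lra].
apply Rdiv_lt_0_compat; nra.
Qed.

Theorem mainTheorem8 (m : nat) (q : R) (hq : 2 < q)
    (alpha : R) (halpha : alpha = (q - 2) / (2 * INR m + q))
    (C1 : R) (hC1 : C1 = Rpower alpha (q - 1) / (1 - alpha)) :
  0 < alpha < 1 /\
  0 < C1 /\
  ~ Lipschitz_at (signed_power alpha) 0 /\
  (forall Theta : R -> R -> R,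
     phase_given_by
       (fun z p => - atan (/ C1 * z ^ (2 * m + 1) * Rpower p q)) Theta ->
     viscosity_solution (fun _ z p => Theta z p) (-1) 1 (signed_power alpha) /\
     ~ phase_z_nonneg Theta) /\
  (m = 0%nat ->
     alpha = (q - 2) / q /\
     forall Theta : R -> R -> R,
       phase_given_by
         (fun z p =>
            - atan ((1 - alpha) * Rpower alpha (1 - q) * z * Rpower p q))
         Theta ->
       viscosity_solution (fun _ z p => Theta z p) (-1) 1
         (signed_power alpha)).
Proof.
assert (hm := pos_INR m).
assert (ha : 0 < alpha < 1).
{ subst alpha; split.
  - apply Rdiv_lt_0_compat; lra.
  - apply (Rmult_lt_reg_r (2 * INR m + q)); [lra | ].
    unfold Rdiv; rewrite Rmult_assoc, Rinv_l; lra. }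
assert (heq : alpha * (2 * INR m + q) = q - 2) by (subst alpha; field; lra).
assert (hpow := Rpower_pos alpha (q - 1)).
assert (hC : 0 < C1) by (subst C1; apply Rdiv_lt_0_compat; lra).
assert (hCinv : / C1 = (1 - alpha) / Rpower alpha (q - 1))
  by (subst C1; field; lra).
assert (Hvisc : forall Theta : R -> R -> R,
  phase_given_by
    (fun z p => - atan (/ C1 * z ^ (2 * m + 1) * Rpower p q)) Theta ->
  viscosity_solution (fun _ z p => Theta z p) (-1) 1 (signed_power alpha)).
{ intros Theta HTheta; apply signed_power_viscosity_solution; [exact ha | ].
  intros x hx; rewrite HTheta.
  - rewrite hCinv, signed_power_equation by (assumption || lra).
    rewrite atan_opp; ring.
  (* The slope is positive, so the prescribed formula applies to it. *)
  - apply Rmult_lt_0_compat; [lra | apply Rpower_pos]. }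
split; [exact ha | split; [exact hC | split; [ | split]]].
- apply signed_power_not_Lipschitz_at_0; lra.
- intros Theta HTheta; split; [now apply Hvisc | ].
  exact (phase_z_nonneg_fails m q _ Theta (Rinv_0_lt_compat _ hC) HTheta).
- intros ->; split.
  + rewrite halpha; simpl; f_equal; ring.
  + intros Theta HTheta; apply Hvisc; intros z p hp; rewrite HTheta by exact hp.
    (* The coefficient is [/ C1] with the denominator written as a negative power, so the case
       [m = 0] is an instance of [Hvisc]. *)
    replace (1 - q) with (- (q - 1)) by ring.
    rewrite Rpower_Ropp, hCinv; simpl (2 * 0 + 1)%nat; rewrite pow_1.
    reflexivity.
Qed.
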